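(* $\mathbf{BQ2P}=\mathbf{BQ1P}$.
   Context: For $w\ge1$ let $\mathcal{A}_w$ be the algebra of $2^w\times 2^w$ complex matrices acting on $w$ qubits; $X_j,Z_j$ are the Pauli operators on qubit $j$. Gate alphabet: $G_w\subset\mathcal{A}_w$ consists of the identity, all CNot gates $\frac12(1+Z_j+X_k-Z_jX_k)$ with $j\ne k$, all Hadamard gates $\frac{1}{\sqrt2}(X_j+Z_j)$, and all gates $\exp(iZ_j\pi/8)$. Circuits: a circuit of width $w$ with $n$ classical input bits is a finite list of triples $(i,A,B)$ with $1\le i\le n$ and $A,B\in G_w$. On classical input $x\in\{0,1\}^n$ each triple contributes the unitary $A$ if $x_i=0$ and $B$ if $x_i=1$; the product of the selected unitaries, in the order listed, is a unitary $U(x)\in\mathcal{A}_w$. A family $(C_n)_n$ of circuits ($C_n$ having $n$ classical input bits) is uniform if a deterministic logspace Turing machine outputs the description of $C_n$ on input $1^n$; widths and sizes are then polynomially bounded. One pure qubit: the circuit is applied to the starting state $(1+Z_1)/2^w$ and the first qubit is measured in the computational basis; the probability of outcome $0$ is $(1+\beta(x))/2$ with $\beta(x)=\mathrm{Tr}[U(x)Z_1U(x)^\dagger Z_1]/2^w$. Two pure qubits ($w\ge2$): the circuit is applied to the starting state $(1+Z_1)(1+Z_2)/2^w$ and the first qubit is measured in the computational basis; $\beta_{2,1}(x)$ is the real number defined by $$\frac{1+\beta_{2,1}(x)}{2}=\mathrm{Tr}\left[U(x)\cdot\frac{(1+Z_1)(1+Z_2)}{2^w}\cdot U(x)^\dagger\cdot\frac{1+Z_1}{2}\right].$$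 $\mathbf{BQ1P}$ is the class of languages $\mathcal{L}\subseteq\{0,1\}^*$ for which there are a uniform family of circuits and a polynomially bounded positive function $q$ such that every $x\in\mathcal{L}$ has $\beta(x)\ge 1/q(|x|)$ and every $x\notin\mathcal{L}$ has $\beta(x)\le-1/q(|x|)$. $\mathbf{BQ2P}$ is defined in the same way with $\beta_{2,1}(x)$ in place of $\beta(x)$. *)

(* Defs.v *)
From HB Require Import structures.
From mathcomp Require Import all_boot all_order all_algebra.
From mathcomp Require Import all_classical all_reals all_analysis.
From mathcomp Require Import complex.

Set Implicit Arguments.
Unset Strict Implicit.
Unset Printing Implicit Defensive.

Import Order.TTheory GRing.Theory Num.Theory.
Import numFieldNormedType.Exports.

Local Open Scope classical_set_scope.
Local Open Scope complex_scope.
Local Open Scope ring_scope.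

(** * Matrices on [w] qubits *)

Section Qubits.
Variable R : realType.

(** Basis states of [w] qubits are indexed by ['I_(2 ^ w)]; the value of qubit
    [j] is the [j]-th binary digit of the index.  Qubits are numbered from 0,
    so that the first qubit is qubit 0. *)
Definition qubit (w j : nat) (a : 'I_(2 ^ w)) : bool := odd (a %/ 2 ^ j).

Definition pauliZ (w j : nat) : 'M[R[i]]_(2 ^ w) :=
  \matrix_(a, b) if a == b then (-1) ^+ qubit j a else 0.

Definition pauliX (w j : nat) : 'M[R[i]]_(2 ^ w) :=
  \matrix_(a, b)
    [forall k : 'I_w, qubit k a == qubit k b (+) ((k : nat) == j)]%:R.

Definition adjoint (m : nat) (A : 'M[R[i]]_m) : 'M[R[i]]_m :=
  (map_mx conjc A)^T.

(** The matrix exponential, i.e. the entrywise limit of the partial sums of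
    the exponential series. *)
Definition exp_partial (m : nat) (A : 'M[R[i]]_m) (N : nat) : 'M[R[i]]_m :=
  \sum_(k < N) (k`!%:R)^-1 *: A ^+ k.

Definition expmx (m : nat) (A : 'M[R[i]]_m) : 'M[R[i]]_m :=
  \matrix_(a, b)
    ((lim ((fun N => complex.Re (exp_partial A N a b)) @ \oo) : R) +i*
     (lim ((fun N => complex.Im (exp_partial A N a b)) @ \oo) : R)).

End Qubits.

(** * Circuits *)

(** Names of the elements of the gate alphabet at width [w]. *)
Inductive gate (w : nat) : Type :=
| GId
| GCNot (j k : 'I_w) of j != k
| GHadamard (j : 'I_w)
| GPhase (j : 'I_w).

Definition gate_mx (R : realType) (w : nat) (g : gate w) : 'M[R[i]]_(2 ^ w) :=
  match g with
  | GId => 1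
  | GCNot j k _ =>
      2%:R^-1 *: (1 + pauliZ R w j + pauliX R w k
                  - pauliZ R w j * pauliX R w k)
  | GHadamard j =>
      ((Num.sqrt 2%:R)^-1)%:C *: (pauliX R w j + pauliZ R w j)
  | GPhase j => expmx (('i * (pi / 8%:R)%:C) *: pauliZ R w j)
  end.

Record circuit (n : nat) : Type := Circuit {
  width : nat;
  width_gt0 : (0 < width)%N;
  steps : seq ('I_n * gate width * gate width)
}.

(** The factors are multiplied from left to right in the order listed. *)
Definition unitary (R : realType) (n : nat) (c : circuit n)
    (x : n.-tuple bool) : 'M[R[i]]_(2 ^ width c) :=
  \prod_(s <- steps c)
    let: (i, A, B) := s in gate_mx R (if tnth x i then B else A).

Definition beta1 (R : realType) (n : nat) (c : circuit n)
    (x : n.-tuple bool) : R[i] :=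
  let w := width c in
  let U := unitary R c x in
  \tr (U * pauliZ R w 0 * adjoint U * pauliZ R w 0) / 2%:R ^+ w.

(** The probability of outcome 0 with two pure qubits. *)
Definition prob2 (R : realType) (n : nat) (c : circuit n)
    (x : n.-tuple bool) : R[i] :=
  let w := width c in
  let U := unitary R c x in
  \tr (U * ((2%:R ^+ w)^-1 *: ((1 + pauliZ R w 0) * (1 + pauliZ R w 1)))
         * adjoint U * (2%:R^-1 *: (1 + pauliZ R w 0))).

(** The solution [b] of [(1 + b) / 2 = prob2 R c x]. *)
Definition beta2 (R : realType) (n : nat) (c : circuit n)
    (x : n.-tuple bool) : R[i] :=
  2%:R * prob2 R c x - 1.

(** * Deterministic Turing machines with output *)

Inductive move := MoveLeft | Stay | MoveRight.

(** What the input head reads: the input word lies between two end markers. *)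
Inductive input_cell := LeftEnd | InputOne | RightEnd.

(** A deterministic machine with a two-way read-only input tape holding a word
    [1^n], one read-write work tape, infinite to the right, and a write-only
    output tape.  A transition rewrites the scanned work cell, moves the input
    head and the work head, and appends a fixed (possibly empty) word to the
    output; the machine halts when [delta] returns [None]. *)
Record machine (O : Type) : Type := Machine {
  state : finType;
  work_symbol : finType;
  blank : work_symbol;
  start : state;
  delta : state -> input_cell -> work_symbol ->
          option (state * work_symbol * move * move * seq O)
}.

Record config (O : Type) (M : machine O) : Type := Config {
  cstate : state M;
  input_pos : nat;
  work_pos : nat;
  work_tape : nat -> work_symbol M;
  output : seq O
}.

Section Runs.
Variables (O : Type) (M : machine O) (n : nat).

Definition read_input (p : nat) : input_cell :=
  if p == 0%N then LeftEnd else if (p <= n)%N then InputOne else RightEnd.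

(** A left move in the leftmost cell of a tape has no effect. *)
Definition move_head (m : move) (p : nat) : nat :=
  match m with MoveLeft => p.-1 | Stay => p | MoveRight => p.+1 end.

Definition initial : config M :=
  Config (start M) 0 0 (fun=> blank M) [::].

(** The input head never moves beyond the right end marker, in cell [n.+1]. *)
Definition next (c : config M) : option (config M) :=
  match delta (cstate c) (read_input (input_pos c))
              (work_tape c (work_pos c)) with
  | None => None
  | Some (s, a, mi, mw, o) =>
      Some (Config s
        (minn (move_head mi (input_pos c)) n.+1)
        (move_head mw (work_pos c))
        (fun p => if p == work_pos c then a else work_tape c p)
        (output c ++ o))
  end.

Definition config_at (t : nat) : config M :=
  iter t (fun c => odflt c (next c)) initial.

Definition halts_with_output (o : seq O) : Prop :=
  exists t, next (config_at t) = None /\ output (config_at t) = o.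

End Runs.

(** Only the work tape counts towards space. *)
Definition logspace (O : Type) (M : machine O) : Prop :=
  exists c : nat, forall n t : nat,
    (work_pos (config_at M n t) < c * (trunc_log 2 n).+1)%N.

(** * Descriptions of circuits and uniform families *)

Inductive letter := Tally | Sep | LId | LCNot | LHadamard | LPhase.

(** Numbers are written in unary, so that a circuit with a polynomially long
    description has polynomial width and size. *)
Definition encode_nat (m : nat) : seq letter := rcons (nseq m Tally) Sep.

Definition encode_gate (w : nat) (g : gate w) : seq letter :=
  match g with
  | GId => [:: LId]
  | GCNot j k _ => LCNot :: encode_nat j ++ encode_nat k
  | GHadamard j => LHadamard :: encode_nat j
  | GPhase j => LPhase :: encode_nat j
  end.

Definition encode_step (n w : nat) (s : 'I_n * gate w * gate w) : seq letter :=
  let: (i, A, B) := s in encode_nat i ++ encode_gate A ++ encode_gate B.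

Definition encode_circuit (n : nat) (c : circuit n) : seq letter :=
  encode_nat (width c) ++ flatten [seq encode_step s | s <- steps c].

Definition uniform (C : forall n, circuit n) : Prop :=
  exists M : machine letter, logspace M /\
    forall n, halts_with_output M n (encode_circuit (C n)).

(** * The complexity classes *)

Definition positive_poly_bounded (R : realType) (q : nat -> R) : Prop :=
  (forall n, 0 < q n) /\ exists p : {poly R}, forall n, q n <= p.[n%:R].

(** The order on [R[i]] compares real parts of numbers with equal imaginary
    parts; in particular the inequalities below assert that the bias is real. *)
Definition separates (R : realType) (bias : forall n, n.-tuple bool -> R[i])
    (q : nat -> R) (L : set (seq bool)) : Prop :=
  forall n (x : n.-tuple bool),
    (L x -> ((q n)^-1)%:C <= bias n x) /\
    (~ L x -> bias n x <= (- (q n)^-1)%:C).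

Definition BQ1P (R : realType) : set (set (seq bool)) :=
  [set L | exists (C : forall n, circuit n) (q : nat -> R),
    [/\ uniform C, positive_poly_bounded q &
        separates (fun n => beta1 R (C n)) q L]].

Definition BQ2P (R : realType) : set (set (seq bool)) :=
  [set L | exists (C : forall n, circuit n) (q : nat -> R),
    [/\ uniform C, (forall n, (2 <= width (C n))%N), positive_poly_bounded q &
        separates (fun n => beta2 R (C n)) q L]].

(* Main.v *)
(** By unitarity, [beta2] is the normalized trace of
    [U (Z_0 + Z_1 + Z_0 Z_1) U^* Z_0], while [beta1] is that of [U Z_0 U^* Z_0].

    For [BQ1P] inside [BQ2P], insert an idle qubit 1: it is traced out, and only
    the term [Z_0] survives.  For [BQ2P] inside [BQ1P], insert three qubits 1, 2,
    3, which start in the maximally mixed state and act as random bits, and let a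
    fixed gadget [V] act first.  Up to phases [V] is a reversible classical
    circuit on qubits 0 to 4 made of gates that flip a qubit when two others are
    0, and [V Z_0 V^*] averages over the random bits to
    [(Z_0 + Z_4 + Z_0 Z_4) / 4]; so the bias is divided by 4.

    Both changes are made on the description of the circuit by a finite-state
    transducer, which runs along with the machine that outputs the description
    and needs no work space. *)

From HB Require Import structures.
From mathcomp Require Import all_boot all_order all_algebra.
From mathcomp Require Import all_classical all_reals all_analysis.
From mathcomp Require Import complex ring lra zify.
Require Import Defs.

Set Implicit Arguments.
Unset Strict Implicit.
Unset Printing Implicit Defensive.

Import Order.TTheory GRing.Theory Num.Theory.
Import numFieldNormedType.Exports.

(** * Transducing the output of a machine *)

Section Transduction.
Variables (O : Type) (T : Type) (f : T -> O -> T * seq O).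

Fixpoint transduce (t : T) (s : seq O) : T * seq O :=
  if s is x :: s' then
    let r := transduce (f t x).1 s' in (r.1, (f t x).2 ++ r.2)
  else (t, [::]).

Lemma transduce_cat t s1 s2 :
  transduce t (s1 ++ s2) =
    ((transduce (transduce t s1).1 s2).1,
     (transduce t s1).2 ++ (transduce (transduce t s1).1 s2).2).
Proof.
by elim: s1 t => [|x s1 IH] t /=; [case: transduce | rewrite IH catA].
Qed.

Lemma transduce_catE t s1 s2 t1 t2 o1 o2 :
  transduce t s1 = (t1, o1) -> transduce t1 s2 = (t2, o2) ->
  transduce t (s1 ++ s2) = (t2, o1 ++ o2).
Proof. by move=> e1 e2; rewrite transduce_cat e1 /= e2. Qed.

End Transduction.

Section TransducedMachine.
Variables (O : Type) (M : machine O) (T : finType).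
Variables (t0 : T) (f : T -> O -> T * seq O) (final : T -> seq O).

(** [None] is an added halting state: where [M] halts, one more transition emits the final word and
    enters it. *)
Definition transduced_delta (s : option (state M * T)) (i : input_cell)
    (a : work_symbol M) :
    option (option (state M * T) * work_symbol M * move * move * seq O) :=
  if s isn't Some (s, t) then None else
  if delta s i a is Some (s', a', mi, mw, o) then
    let r := transduce f t o in Some (Some (s', r.1), a', mi, mw, r.2)
  else Some (None, a, Stay, Stay, final t).

Definition transduced : machine O :=
  Machine (blank M) (Some (start M, t0)) transduced_delta.

Let running (c : config M) : config transduced :=
  let r := transduce f t0 (output c) in
  @Config O transduced (Some (cstate c, r.1)) (input_pos c) (work_pos c)
    (work_tape c) r.2.

(** Head position and tape are written exactly as [next] produces them, so that [next_running] holds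
    by computation. *)
Let stopped (n : nat) (c : config M) : config transduced :=
  let r := transduce f t0 (output c) in
  @Config O transduced None (minn (input_pos c) n.+1) (work_pos c)
    (fun p => if p == work_pos c then work_tape c (work_pos c)
              else work_tape c p) (r.2 ++ final r.1).

Let next_running n c :
  next n (running c) =
    Some (if next n c is Some c' then running c' else stopped n c).
Proof.
rewrite /next /=; case: delta => [[[[[s a] mi] mw] o]|] //.
by rewrite /running /= transduce_cat.
Qed.

Lemma config_at_halted n s t : next n (config_at M n s) = None -> (s <= t)%N ->
  config_at M n t = config_at M n s.
Proof.
move=> halt; elim: t => [|t IH]; first by rewrite leqn0 => /eqP->.
rewrite leq_eqVlt => /orP[/eqP-> // | /IH e].
by rewrite /config_at iterS -/(config_at M n t) e halt.
Qed.

(** Simulation in lockstep: the work head is always where [M] has it, hence the same space bound. *)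
Let config_at_transduced n t :
  config_at transduced n t = running (config_at M n t) \/
  exists s, next n (config_at M n s) = None /\
    config_at transduced n t = stopped n (config_at M n s).
Proof.
elim: t => [|t [IH|[s [halt IH]]]]; first by left.
- rewrite /config_at !iterS -!/(config_at _ n t) IH next_running /=.
  case E: (next n (config_at M n t)) => [c|]; first by left.
  by right; exists t.
- by right; exists s; rewrite /config_at iterS -/(config_at _ n t) IH.
Qed.

Lemma logspace_transduced : logspace M -> logspace transduced.
Proof.
move=> [c bound]; exists c => n t.
by case: (config_at_transduced n t) => [->|[s [_ ->]]]; apply: bound.
Qed.

Lemma transduced_halts n o : halts_with_output M n o ->
  halts_with_output transduced n
    ((transduce f t0 o).2 ++ final (transduce f t0 o).1).
Proof.
move=> [t [halt <-]].
case: (config_at_transduced n t) => [e|[s [halts e]]].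
- exists t.+1; rewrite /config_at iterS -/(config_at _ n t) e next_running.
  by rewrite halt.
- exists t; rewrite e; split=> //.
  (* A halted configuration never changes, so the halting times [s] and [t] give the same output. *)
  suff -> : config_at M n s = config_at M n t by [].
  by case: (leqP s t) => [st|/ltnW ts];
    [rewrite (config_at_halted halts st) | rewrite (config_at_halted halt ts)].
Qed.

End TransducedMachine.

(** * Widening a circuit *)

(** The measured qubit 0 stays in place; positions 1, .., [k] become free for the new qubits. *)
Definition shiftq (k j : nat) : nat := if j == 0%N then 0%N else (j + k)%N.

Lemma shiftq_inj k : injective (shiftq k).
Proof. by rewrite /shiftq => -[|i] [|j] /=; lia. Qed.

Lemma shiftq_lt k w j : (j < w)%N -> (shiftq k j < w + k)%N.
Proof. by rewrite /shiftq; case: eqP => /=; lia. Qed.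

Definition shift_ord k w (j : 'I_w) : 'I_(w + k) :=
  Ordinal (shiftq_lt k (ltn_ord j)).

Lemma shift_ord_inj k w : injective (@shift_ord k w).
Proof. by move=> i j /(congr1 val) /= /shiftq_inj /val_inj. Qed.

Lemma shift_ord_neq k w (i j : 'I_w) :
  i != j -> shift_ord k i != shift_ord k j.
Proof. by rewrite (inj_eq (@shift_ord_inj k w)). Qed.

Definition shift_gate k w (g : gate w) : gate (w + k) :=
  match g with
  | GId => GId _
  | GCNot i j ij => GCNot (shift_ord_neq k ij)
  | GHadamard j => GHadamard (shift_ord k j)
  | GPhase j => GPhase (shift_ord k j)
  end.

Definition shift_step k n w (s : 'I_n * gate w * gate w) :=
  let: (i, A, B) := s in (i, shift_gate k A, shift_gate k B).

(** Index 0 is encoded as the single letter [Sep], so the code of a gadget step does not depend on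
    the circuit. *)
Definition first_ord n (i : 'I_n) : 'I_n :=
  Ordinal (leq_ltn_trans (leq0n i) (ltn_ord i)).

(** The gates [G] ignore the input, but a step needs an input index: there is
    none for [n = 0], where they are therefore left out. *)
Definition gadget_steps n w v (G : seq (gate v))
    (s : seq ('I_n * gate w * gate w)) : seq ('I_n * gate v * gate v) :=
  if s is (i, _, _) :: _ then [seq (first_ord i, g, g) | g <- G] else [::].

(** The gadget is listed last because the last factor of the product acts first on the state. *)
Definition widen k (G : forall w, seq (gate w)) n (c : circuit n) : circuit n :=
  @Circuit n (width c + k) (ltn_addr k (width_gt0 c))
    ([seq shift_step k s | s <- steps c] ++
     gadget_steps (G (width c + k)%N) (steps c)).

(** A state [(b1, b2, fresh, seen)] tells whether the next number, and the one
    after it, are qubits to be shifted, whether the next letter starts a number,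
    and whether the circuit has a step.  The width, being positive, is widened
    by the same rule as a qubit. *)
Definition shift_letter k (t : bool * bool * bool * bool) (l : letter) :
    (bool * bool * bool * bool) * seq letter :=
  let: (b1, b2, fresh, seen) := t in
  match l with
  | Tally => ((b1, b2, false, seen), nseq (if fresh && b1 then k.+1 else 1) l)
  | Sep => ((b2, false, true, seen), [:: l])
  | LId => ((false, false, true, true), [:: l])
  | LCNot => ((true, true, true, true), [:: l])
  | LHadamard | LPhase => ((true, false, true, true), [:: l])
  end.

(** The first tally of a shifted number becomes [k.+1] tallies; 0 has no tally and stays 0, as
    [shiftq] demands. *)
Lemma transduce_nat k b1 b2 seen m :
  transduce (shift_letter k) (b1, b2, true, seen) (encode_nat m) =
    ((b2, false, true, seen), encode_nat (if b1 then shiftq k m else m)).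
Proof.
have tallies p : transduce (shift_letter k) (b1, b2, false, seen)
    (encode_nat p) = ((b2, false, true, seen), encode_nat p).
  by rewrite /encode_nat; elim: p => //= p ->.
case: m => [|m] /=; first by case: (b1).
rewrite -/(encode_nat m) tallies; case: (b1) => //=.
by rewrite /shiftq addSn addnC /encode_nat /= nseqD rcons_cat.
Qed.

Lemma transduce_gate k w (g : gate w) seen :
  transduce (shift_letter k) (false, false, true, seen) (encode_gate g) =
    ((false, false, true, true), encode_gate (shift_gate k g)).
Proof.
by case: g => [|i j ij|j|j] //=;
  rewrite ?transduce_nat // (transduce_catE (transduce_nat _ _ _ _ _)
    (transduce_nat _ _ _ _ _)).
Qed.

Lemma transduce_steps k n w (s : seq ('I_n * gate w * gate w)) seen :
  transduce (shift_letter k) (false, false, true, seen)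
      (flatten [seq encode_step x | x <- s]) =
    ((false, false, true, seen || ~~ nilp s),
     flatten [seq encode_step (shift_step k x) | x <- s]).
Proof.
elim: s seen => [|[[i A] B] s IH] seen; first by rewrite orbF.
rewrite orbT [LHS]/= -/(encode_step (i, A, B)).
apply: transduce_catE (IH true).
apply: transduce_catE (transduce_nat _ _ _ _ _) _.
by apply: transduce_catE; apply: transduce_gate.
Qed.

(** [Sep] is input index 0; each gate is written twice, once for each value of the input bit. *)
Definition constant_word w (G : seq (gate w)) : seq letter :=
  flatten [seq Sep :: encode_gate g ++ encode_gate g | g <- G].

Lemma encode_gadget_steps n w v (G : seq (gate v))
    (s : seq ('I_n * gate w * gate w)) :
  flatten [seq encode_step x | x <- gadget_steps G s] =
    if nilp s then [::] else constant_word G.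
Proof.
case: s => [|[[i A] B] s] //=.
by rewrite -map_comp; congr flatten; apply: eq_map.
Qed.

(** As the gadget has the same code for all [n], a finite-state transducer can emit it as its final
    word, provided that it has seen a step. *)
Lemma uniform_widen k (G : forall w, seq (gate w)) (C : forall n, circuit n)
    (word : seq letter) :
  (forall n, constant_word (G (width (C n) + k)%N) = word) ->
  uniform C -> uniform (fun n => widen k G (C n)).
Proof.
move=> gadgetE [M [logM outM]].
exists (transduced M (true, false, true, false) (shift_letter k)
  (fun t => if t.2 then word else [::])).
split; first exact: logspace_transduced.
move=> n; have := transduced_halts (true, false, true, false)
  (shift_letter k) (fun t => if t.2 then word else [::]) (outM n).
rewrite /encode_circuit (transduce_catE (transduce_nat _ _ _ _ _)
  (transduce_steps _ _ _)) /= /shiftq eqn0Ngt width_gt0 /=.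
rewrite map_cat flatten_cat encode_gadget_steps gadgetE -map_comp catA.
by case: nilp.
Qed.

(** * The gadget *)

(** These are the identity gate when a qubit is out of range. *)
Definition cnot_gate w (j k : nat) : gate w :=
  if (insub j, insub k) is (Some j', Some k') then
    if decP (@idP (j' != k')) is left jk then GCNot jk else GId w
  else GId w.

Definition hadamard_gate w (j : nat) : gate w :=
  if insub j is Some j' then GHadamard j' else GId w.

Definition phase_gate w (j : nat) : gate w :=
  if insub j is Some j' then GPhase j' else GId w.

(** Read as a classical circuit, this flips qubit [q] when qubits [c] and [d]
    are both 0. *)
Definition nor_gadget (c d q w : nat) : seq (gate w) :=
  let H := hadamard_gate w q in let T := phase_gate w q in
  let C := cnot_gate w c q in let D := cnot_gate w d q in
  [:: H; T; C; T; D; T; C; T; D; H].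

(** The first two pieces together negate qubit 4: one flips it when qubit 2 is 0, the other when it
    is 1. The rest follows the assignments of [mux], with qubits 0, 4, 1, 2, 3 as [x], [t], [a],
    [c], [d]. *)
Definition mux_gadget (w : nat) : seq (gate w) :=
  nor_gadget 2 2 4 w ++ [:: cnot_gate w 2 4] ++ nor_gadget 4 2 0 w ++
  nor_gadget 2 3 4 w ++ [:: cnot_gate w 0 4] ++ nor_gadget 1 4 0 w.

Lemma encode_cnot_gate w j k : (j < w)%N -> (k < w)%N -> j != k ->
  encode_gate (cnot_gate w j k) = LCNot :: encode_nat j ++ encode_nat k.
Proof.
move=> jw kw jk; rewrite /cnot_gate (insubT (fun i => i < w)%N jw).
by rewrite (insubT (fun i => i < w)%N kw); case: decP.
Qed.

Lemma encode_hadamard_gate w j : (j < w)%N ->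
  encode_gate (hadamard_gate w j) = LHadamard :: encode_nat j.
Proof.
by move=> jw; rewrite /hadamard_gate (insubT (fun i => i < w)%N jw).
Qed.

Lemma encode_phase_gate w j : (j < w)%N ->
  encode_gate (phase_gate w j) = LPhase :: encode_nat j.
Proof. by move=> jw; rewrite /phase_gate (insubT (fun i => i < w)%N jw). Qed.

(** Codes of gates mention qubit numbers but never the width. *)
Lemma constant_word_mux w : (4 < w)%N ->
  constant_word (mux_gadget w) = constant_word (mux_gadget 5).
Proof.
move=> w4; have lt i : (i <= 4)%N -> (i < w)%N.
  by move=> i4; apply: leq_ltn_trans w4.
by rewrite /constant_word /= !(encode_cnot_gate, encode_hadamard_gate,
  encode_phase_gate) ?lt.
Qed.

(** * Basis states *)

Fixpoint nat_of_bits (w : nat) (f : nat -> bool) : nat :=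
  if w is w'.+1 then (f 0%N + (nat_of_bits w' (fun j => f j.+1)).*2)%N else 0%N.

Lemma nat_of_bits_lt w f : (nat_of_bits w f < 2 ^ w)%N.
Proof.
elim: w f => [|w IH] f //=; have := IH (fun j => f j.+1).
by rewrite expnS; case: (f 0%N); lia.
Qed.

Lemma odd_nat_of_bits w f j : (j < w)%N -> odd (nat_of_bits w f %/ 2 ^ j) = f j.
Proof.
elim: w f j => [|w IH] f [|j] //=.
  by rewrite expn0 divn1 oddD odd_double addbF oddb.
rewrite ltnS => jw; rewrite expnS divnMA divn2 halfD odd_double andbF add0n.
by rewrite doubleK (_ : (f 0%N : nat)./2 = 0%N) ?IH //; case: (f 0%N).
Qed.

Lemma eq_nat_bits w a b : (a < 2 ^ w)%N -> (b < 2 ^ w)%N ->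
  (forall j, (j < w)%N -> odd (a %/ 2 ^ j) = odd (b %/ 2 ^ j)) -> a = b.
Proof.
elim: w a b => [|w IH] a b.
  by rewrite expn0 !ltnS !leqn0 => /eqP-> /eqP->.
rewrite expnS => aw bw ab.
rewrite -(odd_double_half a) -(odd_double_half b).
have := ab 0%N isT; rewrite expn0 !divn1 => ->; congr (_ + _.*2)%N.
apply: IH => [||j jw]; [lia|lia|].
by have := ab j.+1 jw; rewrite expnS !divnMA !divn2.
Qed.

Definition of_bits w (f : nat -> bool) : 'I_(2 ^ w) :=
  Ordinal (nat_of_bits_lt w f).

Lemma qubit_of_bits w f j : (j < w)%N -> qubit j (of_bits w f) = f j.
Proof. exact: odd_nat_of_bits. Qed.

Lemma eq_qubits w (a b : 'I_(2 ^ w)) :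
  (forall j, (j < w)%N -> qubit j a = qubit j b) -> a = b.
Proof. by move=> ab; apply/val_inj/(eq_nat_bits (ltn_ord a) (ltn_ord b)). Qed.

Definition flip w (j : nat) (a : 'I_(2 ^ w)) : 'I_(2 ^ w) :=
  of_bits w (fun i => qubit i a (+) (i == j)).

Lemma qubit_flip w i j (a : 'I_(2 ^ w)) : (i < w)%N ->
  qubit i (flip j a) = qubit i a (+) (i == j).
Proof. exact: qubit_of_bits. Qed.

Lemma flipK w j : involutive (@flip w j).
Proof. by move=> a; apply: eq_qubits => i iw; rewrite !qubit_flip // addbK. Qed.

Definition cflip w (h : pred 'I_(2 ^ w)) (j : nat) (a : 'I_(2 ^ w)) :=
  if h a then flip j a else a.

Lemma qubit_cflip w (h : pred 'I_(2 ^ w)) i j a : (i < w)%N ->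
  qubit i (cflip h j a) = qubit i a (+) (h a && (i == j)).
Proof. by rewrite /cflip; case: (h a) => iw; rewrite ?qubit_flip ?addbF. Qed.

Lemma cflipK w (h : pred 'I_(2 ^ w)) j :
  (forall a, h (flip j a) = h a) -> involutive (cflip h j).
Proof.
by move=> hj a; rewrite /cflip; case ha: (h a); rewrite ?hj ha ?flipK.
Qed.

(** * Old and new qubits of a widened basis state *)

Definition restrict k w (a : 'I_(2 ^ (w + k))) : 'I_(2 ^ w) :=
  of_bits w (fun j => qubit (shiftq k j) a).

(** The state [a] with its qubits other than [1], .., [k] replaced by [b]. *)
Definition overwrite k w (a : 'I_(2 ^ (w + k))) (b : 'I_(2 ^ w)) :=
  of_bits (w + k) (fun j => if (0 < j <= k)%N then qubit j a
                            else qubit (if j == 0%N then 0%N else j - k) b).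

Section Restriction.
Variables k w : nat.
Implicit Types (a : 'I_(2 ^ (w + k))) (b c : 'I_(2 ^ w)).

Lemma qubit_restrict j a : (j < w)%N ->
  qubit j (restrict a) = qubit (shiftq k j) a.
Proof. exact: qubit_of_bits. Qed.

Lemma qubit_overwrite j a b : (j < w + k)%N ->
  qubit j (overwrite a b) = if (0 < j <= k)%N then qubit j a
    else qubit (if j == 0%N then 0%N else j - k) b.
Proof. exact: qubit_of_bits. Qed.

Lemma restrict_overwrite a b : restrict (overwrite a b) = b.
Proof.
apply: eq_qubits => j jw.
rewrite qubit_restrict // qubit_overwrite ?shiftq_lt //.
rewrite /shiftq; case: j jw => [|j] //= _.
have -> : (j.+1 + k <= k)%N = false by lia.
by rewrite addnK.
Qed.

Lemma overwrite_restrict a : (0 < w)%N -> overwrite a (restrict a) = a.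
Proof.
move=> w0; apply: eq_qubits => j jwk; rewrite qubit_overwrite //.
case: ifP => // jk; rewrite qubit_restrict; last by case: eqP; lia.
by congr qubit; rewrite /shiftq; case: (j =P 0%N) => [->|] //; case: eqP; lia.
Qed.

Lemma overwrite_overwrite a b c : overwrite (overwrite a b) c = overwrite a c.
Proof.
apply: eq_qubits => j jwk; rewrite !qubit_overwrite //.
by case: ifP => // jk; rewrite jk.
Qed.

Lemma restrict_flip j a : (0 < j <= k)%N -> restrict (flip j a) = restrict a.
Proof.
move=> jk; apply: eq_qubits => i iw; rewrite !qubit_restrict //.
rewrite qubit_flip ?shiftq_lt // (_ : _ == _ = false) ?addbF //.
by rewrite /shiftq; case: (i =P 0%N); lia.
Qed.

Lemma overwrite_flip j a : (0 < w)%N -> (j < w)%N ->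
  overwrite a (flip j (restrict a)) = flip (shiftq k j) a.
Proof.
move=> w0 jw; apply: eq_qubits => i iwk.
rewrite qubit_flip // -{3}(overwrite_restrict a w0) !qubit_overwrite //.
case: ifP => ik.
  by rewrite (_ : _ == _ = false) ?addbF // /shiftq; case: (j =P 0%N); lia.
rewrite qubit_flip; last by case: eqP; lia.
by congr (_ (+) _); rewrite /shiftq; case: (i =P 0%N); case: (j =P 0%N); lia.
Qed.

End Restriction.

(** * Monomial matrices *)

Section Matrices.
Variable R : realType.
Local Open Scope classical_set_scope.
Local Open Scope complex_scope.
Local Open Scope ring_scope.
Local Notation C := R[i].

Section Monomial.
Variable m : nat.
Implicit Types (g f : 'I_m -> C) (p : 'I_m -> 'I_m).

Definition mono g p : 'M[C]_m := \matrix_(a, b) (g a *+ (b == p a)).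

Definition diag f : 'M[C]_m := mono f id.

Lemma eq_mono g g' p p' : g =1 g' -> p =1 p' -> mono g p = mono g' p'.
Proof. by move=> gg' pp'; apply/matrixP => a b; rewrite !mxE gg' pp'. Qed.

Lemma eq_diag f f' : f =1 f' -> diag f = diag f'.
Proof. by move=> ff'; apply: eq_mono. Qed.

(** The left factor permutes first, so a list of gates acts on basis indices in list order. *)
Lemma mono_mul g p g' p' :
  mono g p * mono g' p' = mono (fun a => g a * g' (p a)) (p' \o p).
Proof.
apply/matrixP => a b; rewrite !mxE (bigD1 (p a)) //= !mxE eqxx mulr1n.
rewrite big1 ?addr0 => [|c /negPf cp]; last by rewrite !mxE cp mul0r.
by rewrite mulrnAr.
Qed.

Lemma diag_mul f f' : diag f * diag f' = diag (fun a => f a * f' a).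
Proof. exact: mono_mul. Qed.

Lemma mono1 : mono (fun=> 1) id = 1.
Proof. by apply/matrixP => a b; rewrite !mxE eq_sym. Qed.

Lemma diagD f f' : diag f + diag f' = diag (fun a => f a + f' a).
Proof. by apply/matrixP => a b; rewrite !mxE mulrnDl. Qed.

Lemma diagZ c f : c *: diag f = diag (fun a => c * f a).
Proof. by apply/matrixP => a b; rewrite !mxE mulrnAr. Qed.

Lemma adjointE (A : 'M[C]_m) a b : adjoint A a b = conjc (A b a).
Proof. by rewrite !mxE. Qed.

Lemma adjointM (A B : 'M[C]_m) : adjoint (A * B) = adjoint B * adjoint A.
Proof.
apply/matrixP => a b; rewrite adjointE !mxE rmorph_sum /=.
by apply: eq_bigr => c _; rewrite !adjointE rmorphM mulrC.
Qed.

Lemma adjoint1 : adjoint (1 : 'M[C]_m) = 1.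
Proof. by apply/matrixP => a b; rewrite adjointE !mxE eq_sym rmorph_nat. Qed.

Definition monomial p (A : 'M[C]_m) : Prop :=
  injective p /\ exists2 g, (forall a, g a * conjc (g a) = 1) & A = mono g p.

Lemma monomialM p p' A A' :
  monomial p A -> monomial p' A' -> monomial (p' \o p) (A * A').
Proof.
move=> [pI [g g1 ->]] [p'I [g' g'1 ->]]; split; first exact: inj_comp.
rewrite mono_mul; exists (fun a => g a * g' (p a)) => // a.
by rewrite rmorphM mulrACA g1 g'1 mulr1.
Qed.

(** The phases cancel against their conjugates, which is why the gadget need only be correct up to
    phases. *)
Lemma monomial_conj p A f : monomial p A ->
  A * diag f * adjoint A = diag (f \o p).
Proof.
move=> [pI [g g1 ->]]; rewrite mono_mul; apply/matrixP => a b; rewrite !mxE.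
rewrite (bigD1 (p a)) //= adjointE !mxE eqxx mulr1n.
rewrite big1 ?addr0 => [|c /negPf cp]; last by rewrite !mxE cp mul0r.
rewrite (inj_eq pI) eq_sym; case: eqP => [->|_]; last by rewrite conjc0 mulr0.
by rewrite !mulr1n mulrAC g1 mul1r.
Qed.

Lemma trace_mul_diag (A : 'M[C]_m) f : \tr (A * diag f) = \sum_a A a a * f a.
Proof.
apply: eq_bigr => a _; rewrite !mxE (bigD1 a) //= big1 => [|b /negPf ba].
  by rewrite !mxE eqxx addr0.
by rewrite !mxE (eq_sym a b) ba mulr0.
Qed.

Lemma trace_diag f : \tr (diag f) = \sum_a f a.
Proof. by apply: eq_bigr => a _; rewrite !mxE eqxx. Qed.

Definition unitary_mx (A : 'M[C]_m) : Prop := adjoint A * A = 1.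

Lemma unitary_mx1 : unitary_mx 1.
Proof. by rewrite /unitary_mx adjoint1 mulr1. Qed.

Lemma unitary_mxM A B : unitary_mx A -> unitary_mx B -> unitary_mx (A * B).
Proof.
rewrite /unitary_mx adjointM -mulrA => uA uB.
by rewrite [adjoint A * _]mulrA uA mul1r.
Qed.

Lemma monomial_unitary p A : monomial p A -> unitary_mx A.
Proof.
move=> /(monomial_conj (fun=> 1)); rewrite /diag !mono1 mulr1.
exact: mulmx1C.
Qed.

End Monomial.

(** * Matrices of the gates and of the gadget *)

Section Gates.

Lemma pauliZE w j : pauliZ R w j = diag (fun a => (-1) ^+ qubit j a).
Proof.
by apply/matrixP => a b; rewrite !mxE eq_sym; case: eqP.
Qed.

Lemma pauliXE w j : pauliX R w j = mono (fun=> 1) (flip j).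
Proof.
apply/matrixP => a b; rewrite !mxE; congr (_ *+ nat_of_bool _).
apply/forallP/eqP => [ab | -> k].
- apply: eq_qubits => k kw; rewrite qubit_flip //.
  by rewrite (eqP (ab (Ordinal kw))) addbK.
- by rewrite qubit_flip // addbK.
Qed.

Definition expi (t : R) : C := cos t +i* sin t.

Lemma expiD s t : expi (s + t) = expi s * expi t.
Proof.
rewrite /expi cosD sinD; apply/eqP; rewrite eq_complex /=.
by rewrite eqxx addrC mulrC (mulrC (sin s)) addrC mulrC eqxx.
Qed.

Lemma expiN t : expi (- t) = conjc (expi t).
Proof. by rewrite /expi cosN sinN. Qed.

Lemma expi_conj t : expi t * conjc (expi t) = 1.
Proof. by rewrite -expiN -expiD subrr /expi cos0 sin0. Qed.

Lemma exp_term (t : R) n : (n`!%:R)^-1 * ('i * t%:C) ^+ n =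
  cos_coeff t n +i* sin_coeff t n :> C.
Proof.
have -> : (n`!%:R)^-1 * ('i * t%:C) ^+ n = 'i ^+ n * (t ^+ n / n`!%:R)%:C :> C.
  rewrite rmorphM fmorphV rmorphXn rmorph_nat /= exprMn.
  by rewrite mulrA mulrC mulrA mulrC.
(* The parity of [n] decides whether the term is real or imaginary; the exponents are those of
   [cos_coeff] and [sin_coeff]. *)
have -> : 'i ^+ n = (~~ odd n)%:R * (-1) ^+ n./2
                 +i* ((odd n)%:R * (-1) ^+ n.-1./2) :> C.
  rewrite -{1}(odd_double_half n) exprD -mul2n exprM -complexiE sqr_i.
  have -> : (-1 : C) ^+ n./2 = ((-1) ^+ n./2)%:C.
    by rewrite rmorphXn rmorphN1.
  case: (boolP (odd n)) => /= odd_n;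
    rewrite !(mul0r, mul1r) ?expr0 ?expr1 ?mul1r //.
  have -> : n.-1./2 = n./2 by lia.
  by apply/eqP; rewrite eq_complex /= !mul0r !mul1r subrr add0r !eqxx.
apply/eqP; rewrite eq_complex /= !mulr0 subr0 add0r.
by rewrite /cos_coeff /sin_coeff !mulrA !eqxx.
Qed.

Lemma exp_sum (t : R) N : \sum_(k < N) (k`!%:R)^-1 * ('i * t%:C) ^+ k =
  series (cos_coeff t) N +i* series (sin_coeff t) N :> C.
Proof.
elim: N => [|N IH]; first by rewrite big_ord0 /series /= !big_geq.
by rewrite big_ord_recr IH exp_term /series /= !big_nat_recr.
Qed.

Lemma diagX m (f : 'I_m -> C) k : diag f ^+ k = diag (fun a => f a ^+ k).
Proof.
elim: k => [|k IH]; first by rewrite expr0 -mono1.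
by rewrite exprS IH diag_mul; apply: eq_diag => a; rewrite exprS.
Qed.

(** On the diagonal, the partial sums are those of the cosine and sine series, whose limits define
    [cos] and [sin]. *)
Lemma expmx_diag m (t : 'I_m -> R) :
  expmx (diag (fun a => 'i * (t a)%:C)) = diag (fun a => expi (t a)).
Proof.
have partialE N a b : exp_partial (diag (fun a => 'i * (t a)%:C)) N a b =
    (series (cos_coeff (t a)) N +i* series (sin_coeff (t a)) N) *+ (b == a).
  rewrite /exp_partial summxE -exp_sum -sumrMnl; apply: eq_bigr => k _.
  by rewrite diagX !mxE mulrnAr.
apply/matrixP => a b; rewrite !mxE.
under eq_fun do rewrite partialE.
under [X in _ +i* lim (X @ _)]eq_fun do rewrite partialE.
case: eqP => _ /=.
  by rewrite /expi cos.unlock sin.unlock.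
by rewrite !lim_cst.
Qed.

Definition cnot_mx w (j k : nat) : 'M[C]_(2 ^ w) :=
  mono (fun=> 1) (cflip (qubit j) k).

Definition hadamard_mx w (j : nat) : 'M[C]_(2 ^ w) :=
  ((Num.sqrt 2%:R)^-1)%:C *: (pauliX R w j + pauliZ R w j).

Definition phase_mx w (j : nat) : 'M[C]_(2 ^ w) :=
  diag (fun a => expi ((-1) ^+ qubit j a * (pi / 8%:R))).

(** The formula collapses to 1 where Z_j = 1 and to X_k where Z_j = -1. *)
Lemma gate_mx_cnot w (j k : 'I_w) (jk : j != k) :
  gate_mx R (GCNot jk) = cnot_mx w j k.
Proof.
rewrite /= pauliXE pauliZE mono_mul; apply/matrixP => a b; rewrite !mxE /=.
have two : (2%:R : C) != 0 by rewrite pnatr_eq0.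
rewrite /cflip mulr1 (eq_sym a b); case: (qubit j a) => /=;
  rewrite ?expr0 ?expr1; do 2! case: eqP => _ /=;
  rewrite ?mulr1n ?mulr0n; by field.
Qed.

Lemma gate_mx_phase w (j : 'I_w) : gate_mx R (GPhase j) = phase_mx w j.
Proof.
rewrite /phase_mx -expmx_diag /= pauliZE diagZ; congr expmx.
apply: eq_diag => a.
rewrite [in RHS]rmorphM rmorphXn rmorphN1 -mulrA; congr (_ * _).
by rewrite mulrC.
Qed.

Lemma inv_sqrt2_sqr :
  ((Num.sqrt 2%:R)^-1)%:C * ((Num.sqrt 2%:R)^-1)%:C = 2%:R^-1 :> C.
Proof.
rewrite -rmorphM /= -invfM -expr2 sqr_sqrtr ?ler0n //.
by rewrite fmorphV rmorph_nat.
Qed.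

(** Conjugation by a Hadamard turns [exp(i h Z_q pi / 2)] into [exp(i h X_q pi /
    2)], which is the flip of qubit [q] on [h], up to phases. *)
Lemma hadamard_conj w (q : nat) (h : pred 'I_(2 ^ w)) : (q < w)%N ->
  (forall a, h (flip q a) = h a) ->
  hadamard_mx w q *
      diag (fun a => expi ((h a)%:R * (-1) ^+ qubit q a * (pi / 2%:R))) *
    hadamard_mx w q =
  mono (fun a => if h a then 'i else 1) (cflip h q).
Proof.
move=> qw hq; have two : (2%:R : C) != 0 by rewrite pnatr_eq0.
have expi0 : expi 0 = 1 by rewrite /expi cos0 sin0.
have : expi (pi / 2%:R) = 'i by rewrite /expi cos_pihalf sin_pihalf complexiE.
move: (pi / 2%:R) => p expi_p; have expi_Np : expi (- p) = - 'i.
  rewrite expiN expi_p -complexiE; apply/eqP.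
  by rewrite eq_complex /= oppr0 !eqxx.
rewrite /hadamard_mx -!mulmxE -!scalemxAl -scalemxAr scalerA !mulmxE.
(* With D the middle factor, XDX + ZDZ is twice the cosine and vanishes on [h]; XDZ + ZDX is 2i
   times the sine times X and vanishes off [h]. *)
rewrite inv_sqrt2_sqr pauliXE pauliZE !(mulrDl, mulrDr) !mono_mul.
apply/matrixP => a b; rewrite !mxE /= !hq flipK qubit_flip // eqxx addbT /cflip.
case: (h a); case: (qubit q a) => /=;
  rewrite ?expr0 ?expr1 ?mul0r ?mul1r ?mulN1r ?mulrN1 ?opprK ?expi0 ?expi_p
    ?expi_Np ?mulr1 ?mulrN1 ?opprK;
  do 2! case: eqP => _ /=; rewrite ?mulr1n ?mulr0n; by field.
Qed.

Definition nor_qubits w (c d : nat) (a : 'I_(2 ^ w)) : bool :=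
  ~~ qubit c a && ~~ qubit d a.

(** The CNots make qubit [q] run through q, q+c, q+c+d, q+d modulo 2 and restore it. The four phases
    add up to (-1)^q (1 + (-1)^c) (1 + (-1)^d) pi/8, which is (-1)^q pi/2 if c = d = 0 and 0
    otherwise. *)
Lemma phase_product w (c d q : nat) : (c < w)%N -> (d < w)%N -> (q < w)%N ->
  c != q -> d != q ->
  phase_mx w q * cnot_mx w c q * phase_mx w q * cnot_mx w d q *
    phase_mx w q * cnot_mx w c q * phase_mx w q * cnot_mx w d q =
  diag (fun a =>
    expi ((nor_qubits c d a)%:R * (-1) ^+ qubit q a * (pi / 2%:R))).
Proof.
move=> cw dw qw /negPf cq /negPf dq; rewrite !mono_mul; apply: eq_mono => a.
- rewrite /= !mulr1 !qubit_cflip // cq dq eqxx !andbT !andbF !addbF /nor_qubits.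
  rewrite -!expiD; congr expi.
  by case: (qubit c a); case: (qubit d a); case: (qubit q a) => /=; field.
- apply: eq_qubits => i iw; rewrite /= !qubit_cflip // cq dq !andbF !addbF.
  by case: (qubit c a); case: (qubit d a); case: (qubit i a); case: (i == q).
Qed.

Lemma monomial_cflip w (h : pred 'I_(2 ^ w)) (j : nat) (z : C) :
  z * conjc z = 1 -> (forall a, h (flip j a) = h a) ->
  monomial (cflip h j) (mono (fun a => if h a then z else 1) (cflip h j)).
Proof.
move=> z1 hj; split; first exact/inv_inj/cflipK.
exists (fun a => if h a then z else 1) => // a.
by case: (h a); rewrite ?conjc1 ?mulr1.
Qed.

Lemma qubit_flip_neq w (i j : nat) (a : 'I_(2 ^ w)) : (i < w)%N -> i != j ->
  qubit i (flip j a) = qubit i a.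
Proof. by move=> iw /negPf ij; rewrite qubit_flip // ij addbF. Qed.

Lemma monomial_cnot w (j k : nat) : (j < w)%N -> j != k ->
  monomial (cflip (qubit j) k) (cnot_mx w j k).
Proof.
move=> jw jk.
have := @monomial_cflip w (qubit j) k 1; rewrite conjc1 mulr1.
have -> : mono (fun a => if qubit j a then 1 else 1) (cflip (qubit j) k) =
    cnot_mx w j k.
  by apply: eq_mono => // a; case: ifP.
by apply=> // a; rewrite qubit_flip_neq.
Qed.

Lemma monomial_phase w j : monomial id (phase_mx w j).
Proof.
by split=> //; eexists; last by []; move=> a; apply: expi_conj.
Qed.

Lemma unitary_hadamard w j : (j < w)%N -> unitary_mx (hadamard_mx w j).
Proof.
move=> jw; rewrite /unitary_mx.
have -> : adjoint (hadamard_mx w j) = hadamard_mx w j.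
  apply/matrixP => a b; rewrite adjointE /hadamard_mx pauliXE pauliZE !mxE.
  rewrite rmorphM rmorphD /=; congr (_ * (_ + _)).
  - by rewrite oppr0.
  - by rewrite conjc_nat eq_sym (can2_eq (@flipK _ _) (@flipK _ _)).
  - by rewrite rmorphMn rmorphXn rmorphN1 (eq_sym a b); case: eqP => [->|].
have -> : hadamard_mx w j * hadamard_mx w j =
    hadamard_mx w j * diag (fun=> 1) * hadamard_mx w j.
  by rewrite /diag mono1 mulr1.
(* The square is the case of the empty predicate in [hadamard_conj]. *)
have -> : diag (fun=> 1) =
    diag (fun a => expi ((xpred0 a)%:R * (-1) ^+ qubit j a * (pi / 2%:R)))
    :> 'M[C]_(2 ^ w).
  by apply: eq_diag => a; rewrite !mul0r /expi cos0 sin0.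
by rewrite hadamard_conj // -mono1; apply: eq_mono.
Qed.

Lemma unitary_gate w (g : gate w) : unitary_mx (gate_mx R g).
Proof.
case: g => [|i j ij|j|j].
- exact: unitary_mx1.
- by rewrite gate_mx_cnot; apply/monomial_unitary/monomial_cnot.
- exact: unitary_hadamard.
- by rewrite gate_mx_phase; apply/monomial_unitary/monomial_phase.
Qed.

Lemma unitary_circuit n (c : circuit n) x : unitary_mx (unitary R c x).
Proof.
rewrite /unitary; elim: (steps c) => [|[[i A] B] s IH].
  by rewrite big_nil; apply: unitary_mx1.
by rewrite big_cons; apply: unitary_mxM IH; apply: unitary_gate.
Qed.

Lemma gate_mx_cnot_gate w (j k : nat) : (j < w)%N -> (k < w)%N -> j != k ->
  gate_mx R (cnot_gate w j k) = cnot_mx w j k.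
Proof.
move=> jw kw jk; rewrite /cnot_gate (insubT (fun i => i < w)%N jw).
rewrite (insubT (fun i => i < w)%N kw); case: decP => // p.
by rewrite gate_mx_cnot.
Qed.

Lemma gate_mx_hadamard_gate w (j : nat) : (j < w)%N ->
  gate_mx R (hadamard_gate w j) = hadamard_mx w j.
Proof.
by move=> jw; rewrite /hadamard_gate (insubT (fun i => i < w)%N jw).
Qed.

Lemma gate_mx_phase_gate w (j : nat) : (j < w)%N ->
  gate_mx R (phase_gate w j) = phase_mx w j.
Proof.
move=> jw; rewrite /phase_gate (insubT (fun i => i < w)%N jw).
by rewrite gate_mx_phase.
Qed.

Lemma monomial_nor_gadget w (c d q : nat) :
  (c < w)%N -> (d < w)%N -> (q < w)%N -> c != q -> d != q ->
  monomial (cflip (nor_qubits c d) q)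
    (\prod_(g <- nor_gadget c d q w) gate_mx R g).
Proof.
move=> cw dw qw cq dq; rewrite !big_cons big_nil mulr1.
rewrite !gate_mx_cnot_gate // gate_mx_hadamard_gate // gate_mx_phase_gate //.
have := phase_product cw dw qw cq dq; rewrite -!mulrA => prodE.
(* Isolates the eight inner factors, to which [phase_product] applies, between the two Hadamards. *)
have assoc (S : pzRingType) (A1 A2 A3 A4 A5 A6 A7 A8 B : S) :
    B * (A1 * (A2 * (A3 * (A4 * (A5 * (A6 * (A7 * (A8 * B)))))))) =
    B * (A1 * (A2 * (A3 * (A4 * (A5 * (A6 * (A7 * A8))))))) * B.
  by rewrite -!mulrA.
have norq (a : 'I_(2 ^ w)) : nor_qubits c d (flip q a) = nor_qubits c d a.
  by rewrite /nor_qubits !qubit_flip_neq.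
rewrite assoc prodE hadamard_conj //; apply: monomial_cflip => //.
rewrite -complexiE; apply/eqP.
by rewrite eq_complex /= !mul0r mulr0 mulrN mulr1 opprK add0r addr0 !eqxx.
Qed.

(** This is [x (+) (t && ~~ c)] if [a], and [t (+) (~~ c && ~~ d)] otherwise: the
    mean of [(-1) ^+ mux x t a c d] over [a], [c] and [d] is a quarter of
    [(-1) ^+ x + (-1) ^+ t + (-1) ^+ (x (+) t)]. *)
Definition mux (x t a c d : bool) : bool :=
  let t1 := ~~ t in
  let x1 := x (+) (~~ t1 && ~~ c) in
  let t2 := t1 (+) (~~ c && ~~ d) (+) x1 in
  x1 (+) (~~ a && ~~ t2).

Lemma monomial_mux_gadget w : (4 < w)%N ->
  exists2 p : 'I_(2 ^ w) -> 'I_(2 ^ w),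
    monomial p (\prod_(g <- mux_gadget w) gate_mx R g) &
    forall a, qubit 0 (p a) =
      mux (qubit 0 a) (qubit 4 a) (qubit 1 a) (qubit 2 a) (qubit 3 a).
Proof.
move=> w4; have lt i : (i <= 4)%N -> (i < w)%N.
  by move=> i4; apply: leq_ltn_trans w4.
(* The permutation is left open: [monomialM] assembles it from the controlled flips of the pieces. A
   truth table then compares it with [mux]. *)
eexists.
  rewrite /mux_gadget !big_cat !big_seq1 !gate_mx_cnot_gate ?lt //.
  do ! apply: monomialM; try by apply: monomial_nor_gadget; rewrite ?lt.
  - by apply: monomial_cnot; rewrite ?lt.
  - by apply: monomial_cnot; rewrite ?lt.
move=> a; rewrite /= /nor_qubits !qubit_cflip ?lt //= ?andbT ?andbF ?addbF.
by case: (qubit 0 a); case: (qubit 1 a); case: (qubit 2 a); case: (qubit 3 a);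
  case: (qubit 4 a).
Qed.

End Gates.

(** * Operators that leave the new qubits alone *)

Section Embedding.
Variables k w : nat.
Hypothesis w_gt0 : (0 < w)%N.

(** The operator [A] on the qubits other than [1], .., [k]. *)
Definition embed (A : 'M[C]_(2 ^ w)) : 'M[C]_(2 ^ (w + k)) :=
  \matrix_(a, b)
    (A (restrict a) (restrict b) *+ (b == overwrite a (restrict b))).

Lemma embed_mono g p : embed (mono g p) =
  mono (g \o @restrict k w) (fun a => overwrite a (p (restrict a))).
Proof.
apply/matrixP => a b; rewrite !mxE -mulrnA mulnb; congr (_ *+ nat_of_bool _).
apply/andP/eqP => [[/eqP <- /eqP //] | ->]; rewrite (@restrict_overwrite k w).
by rewrite !eqxx.
Qed.

Lemma embed_diag f : embed (diag f) = diag (f \o @restrict k w).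
Proof.
by rewrite /diag embed_mono; apply: eq_mono => a //; apply: overwrite_restrict.
Qed.

Lemma embed1 : embed 1 = 1.
Proof. by rewrite -mono1 embed_diag /diag -mono1. Qed.

Lemma embedD A B : embed (A + B) = embed A + embed B.
Proof. by apply/matrixP => a b; rewrite !mxE mulrnDl. Qed.

Lemma embedB A B : embed (A - B) = embed A - embed B.
Proof. by apply/matrixP => a b; rewrite !mxE mulrnBl. Qed.

Lemma embedZ c A : embed (c *: A) = c *: embed A.
Proof. by apply/matrixP => a b; rewrite !mxE mulrnAr. Qed.

Lemma embedM A B : embed (A * B) = embed A * embed B.
Proof.
apply/matrixP => a c; rewrite !mxE -sumrMnl.
(* Only intermediate states that agree with [a] on the new qubits contribute; they are the
   [overwrite a b]. *)
rewrite [RHS](bigID (fun b => b == overwrite a (restrict b))) /=.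
rewrite [X in _ + X]big1 ?addr0 => [|b /negPf ab]; last first.
  by rewrite !mxE ab mul0r.
rewrite (reindex_onto (overwrite a) (@restrict k w)) => [|b /eqP <- //].
rewrite [RHS](eq_bigl predT) => [|b]; last first.
  by rewrite (@restrict_overwrite k w) !eqxx.
apply: eq_bigr => b _.
rewrite !mxE !(@restrict_overwrite k w) overwrite_overwrite.
by rewrite eqxx mulr1n mulrnAr.
Qed.

Lemma embed_prod (I : Type) (r : seq I) (F : I -> 'M[C]_(2 ^ w)) :
  embed (\prod_(i <- r) F i) = \prod_(i <- r) embed (F i).
Proof. by apply: (big_morph _ embedM embed1). Qed.

Lemma embed_adjoint A : embed (adjoint A) = adjoint (embed A).
Proof.
apply/matrixP => a b; rewrite adjointE !mxE rmorphMn.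
congr (_ *+ nat_of_bool _).
by apply/eqP/eqP => ->;
  rewrite (@overwrite_overwrite k w) overwrite_restrict.
Qed.

Lemma embed_pauliZ j : (j < w)%N ->
  embed (pauliZ R w j) = pauliZ R (w + k) (shiftq k j).
Proof.
move=> jw; rewrite !pauliZE embed_diag; apply: eq_diag => a /=.
by rewrite qubit_restrict.
Qed.

Lemma embed_pauliX j : (j < w)%N ->
  embed (pauliX R w j) = pauliX R (w + k) (shiftq k j).
Proof.
move=> jw; rewrite !pauliXE embed_mono; apply: eq_mono => a //=.
exact: overwrite_flip.
Qed.

Lemma embed_gate (g : gate w) :
  embed (gate_mx R g) = gate_mx R (shift_gate k g).
Proof.
case: g => [|i j ij|j|j].
- exact: embed1.
- by rewrite /= embedZ embedB !embedD embedM embed1 !embed_pauliZ ?embed_pauliX.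
- by rewrite /= embedZ embedD embed_pauliX // embed_pauliZ.
- rewrite !gate_mx_phase embed_diag; apply: eq_diag => a /=.
  by rewrite qubit_restrict.
Qed.

Lemma embed_steps n (x : n.-tuple bool) (s : seq ('I_n * gate w * gate w))
    (G : seq (gate (w + k))) :
  \prod_(t <- [seq shift_step k t | t <- s] ++ gadget_steps G s)
     (let: (i, A, B) := t in gate_mx R (if tnth x i then B else A)) =
  embed (\prod_(t <- s)
     (let: (i, A, B) := t in gate_mx R (if tnth x i then B else A))) *
  (if nilp s then 1 else \prod_(g <- G) gate_mx R g).
Proof.
rewrite big_cat big_map embed_prod; congr (_ * _).
  by apply: eq_bigr => -[[i A] B] _ /=; case: ifP; rewrite embed_gate.
case: s => [|[[i A] B] s] /=; first by rewrite big_nil.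
by rewrite big_map; apply: eq_bigr => g _; case: ifP.
Qed.

Lemma sum_restrict (h : 'I_(2 ^ w) -> C) :
  (\sum_a h (@restrict k w a)) / 2%:R ^+ (w + k) = (\sum_b h b) / 2%:R ^+ w.
Proof.
(* Exchanging the old qubits of [a] with [b] is an involution on pairs; it equates 2^w times the
   left sum with 2^(w+k) times the right one. *)
pose sw (ab : 'I_(2 ^ (w + k)) * 'I_(2 ^ w)) :=
  (overwrite ab.1 ab.2, restrict ab.1).
have swK : involutive sw.
  by case=> a b; rewrite /sw /= overwrite_overwrite (@restrict_overwrite k w)
    overwrite_restrict.
have : \sum_(ab : _ * 'I_(2 ^ w)) h (@restrict k w ab.1) =
    \sum_(ab : _ * 'I_(2 ^ w)) h (sw ab).2 by [].
rewrite [RHS](reindex_inj (inv_inj swK)) /=.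
under [RHS]eq_bigr do rewrite (@restrict_overwrite k w).
rewrite -(pair_bigA _ (fun a _ => h (restrict a))) /=.
rewrite -(pair_bigA _ (fun _ b => h b)) /=.
under eq_bigr do rewrite sumr_const card_ord.
rewrite sumr_const card_ord -sumrMnl => sums.
have two n : (2%:R ^+ n : C) != 0 by rewrite expf_neq0 ?pnatr_eq0.
apply/eqP; rewrite eqr_div //; apply/eqP.
by rewrite -!natrX !mulr_natr -!sumrMnl.
Qed.

Lemma trace_embed_diag (B : 'M[C]_(2 ^ w)) f :
  \tr (embed B * diag f) = \sum_a B (restrict a) (restrict a) * f a.
Proof.
rewrite trace_mul_diag; apply: eq_bigr => a _.
by rewrite !mxE overwrite_restrict // eqxx.
Qed.

Lemma sum_restrict_flip (F : 'I_(2 ^ w) -> C) (f : 'I_(2 ^ (w + k)) -> C) j :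
  (0 < j <= k)%N ->
  \sum_a F (restrict a) * f (flip j a) = \sum_a F (restrict a) * f a.
Proof.
move=> jk; rewrite [RHS](reindex_inj (inv_inj (@flipK _ j))).
by apply: eq_bigr => a _; rewrite restrict_flip.
Qed.

End Embedding.

(** * The biases of a widened circuit *)

Section Biases.

Lemma unitary_widen k (G : forall w, seq (gate w)) n (c : circuit n) x :
  unitary R (widen k G c) x =
    embed k (unitary R c x) *
    (if nilp (steps c) then 1 else \prod_(g <- G (width c + k)%N) gate_mx R g).
Proof. exact: (embed_steps (width_gt0 c)). Qed.

Lemma trace_diag_odd w j (f : 'I_(2 ^ w) -> C) :
  (forall a, f (flip j a) = - f a) -> \tr (diag f) = 0.
Proof.
move=> fN; rewrite trace_diag; apply/eqP; rewrite -eqNr; apply/eqP.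
rewrite -sumrN [RHS](reindex_inj (inv_inj (@flipK w j))).
by apply: eq_bigr => a _; rewrite fN.
Qed.

Let two_pow_neq0 n : (2%:R ^+ n : C) != 0.
Proof. by rewrite expf_neq0 ?pnatr_eq0. Qed.

Definition sgn (w j : nat) (a : 'I_(2 ^ w)) : C := (-1) ^+ qubit j a.

Lemma sgn_flip w j (a : 'I_(2 ^ w)) : (j < w)%N -> sgn j (flip j a) = - sgn j a.
Proof.
by move=> jw; rewrite /sgn qubit_flip // eqxx signr_addb mulrN1.
Qed.

Lemma sgn_flip_neq w i j (a : 'I_(2 ^ w)) : (i < w)%N -> i != j ->
  sgn i (flip j a) = sgn i a.
Proof. by move=> iw ij; rewrite /sgn qubit_flip_neq. Qed.

(** The diagonal of (1 + Z_s)(1 + Z_t) - 1. *)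
Definition two_pure (w s t : nat) (a : 'I_(2 ^ w)) : C :=
  sgn s a + sgn t a + sgn s a * sgn t a.

(** Expanding the probability gives four traces: that of 1 cancels the -1 in [beta2], those of Z_0
    and of the evolved traceless part vanish, and the fourth remains. *)
Lemma beta2E n (c : circuit n) x : (1 < width c)%N ->
  beta2 R c x =
    \tr (unitary R c x * diag (two_pure 0 1) * adjoint (unitary R c x) *
         pauliZ R (width c) 0) / 2%:R ^+ width c.
Proof.
move=> w1; rewrite /beta2 /prob2; set U := unitary R c x; set w := width c.
have uU : adjoint U * U = 1 := unitary_circuit c x.
have uU' : U * adjoint U = 1 by apply: mulmx1C.
have w0 : (0 < w)%N := width_gt0 c.
have pureE : (1 + pauliZ R w 0) * (1 + pauliZ R w 1) = 1 + diag (two_pure 0 1).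
  rewrite !pauliZE mulrDr mulr1 mulrDl mul1r diag_mul !diagD -addrA.
  congr (1 + _).
  by rewrite !diagD; apply: eq_diag => a; rewrite /two_pure /sgn; ring.
rewrite pureE -!mulmxE -!scalemxAr -!scalemxAl !mxtraceZ !mulmxE.
have -> : U * (1 + diag (two_pure 0 1)) * adjoint U * (1 + pauliZ R w 0) =
    1 + U * diag (two_pure 0 1) * adjoint U +
    (pauliZ R w 0 + U * diag (two_pure 0 1) * adjoint U * pauliZ R w 0).
  rewrite [U * (1 + _)]mulrDr mulr1 [(U + _) * _]mulrDl uU' mulrDr mulr1.
  by rewrite mulrDl mul1r.
rewrite !mxtraceD.
have tr0 : \tr (diag (@sgn w 0)) = 0.
  by apply: (trace_diag_odd (j := 0)) => a; apply: sgn_flip.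
have tr1 : \tr (diag (@sgn w 1)) = 0.
  by apply: (trace_diag_odd (j := 1)) => a; apply: sgn_flip.
have -> : \tr (U * diag (two_pure 0 1) * adjoint U) = 0.
  rewrite -!mulmxE mxtrace_mulC mulmxA !mulmxE uU mul1r.
  rewrite trace_diag /two_pure !big_split /= -!trace_diag tr0 tr1 !add0r.
  apply: (trace_diag_odd (j := 0)) => a.
  by rewrite sgn_flip // sgn_flip_neq // mulNr.
rewrite [pauliZ R w 0]pauliZE tr0.
rewrite mxtrace1 !addr0 add0r natrX.
have := two_pow_neq0 w; have : (2%:R : C) != 0 by rewrite pnatr_eq0.
by move=> ? ?; field.
Qed.

(** Heisenberg picture: cyclicity of the trace moves [U] onto the observable, and the diagonal
    initial operator sees only its diagonal. *)
Lemma trace_evolved m (U : 'M[C]_m) f (Z : 'M[C]_m) :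
  \tr (U * diag f * adjoint U * Z) =
  \sum_a (adjoint U * Z * U) a a * f a.
Proof.
rewrite -trace_mul_diag -[U * _ * _ * Z]mulrA -[U * _ * _]mulrA.
rewrite -mulmxE mxtrace_mulC mulmxE -!mulrA.
by rewrite -mulmxE mxtrace_mulC mulmxE -!mulrA.
Qed.

(** [V] is absorbed into the initial operator; the evolved observable involves only old qubits, so
    its diagonal depends on [restrict a] alone. *)
Lemma trace_widened k w (U : 'M[C]_(2 ^ w)) V f f' : (0 < w)%N ->
  V * diag f * adjoint V = diag f' ->
  \tr (embed k U * V * diag f * adjoint (embed k U * V) * pauliZ R (w + k) 0) =
  \sum_a (adjoint U * pauliZ R w 0 * U) (restrict a) (restrict a) * f' a.
Proof.
move=> w0 VV; rewrite -trace_embed_diag // trace_mul_diag !embedM //.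
rewrite (embed_pauliZ k w0 w0) embed_adjoint // -trace_evolved -VV adjointM.
by rewrite !mulrA.
Qed.

(** The weights ignore the new qubit [j], so [f] may be averaged over it; the factor 2 clears the
    denominator. *)
Lemma trace_ancilla k w (F : 'I_(2 ^ w) -> C) (f : 'I_(2 ^ (w + k)) -> C) j :
  (0 < j <= k)%N ->
  \sum_a F (restrict a) * (f a + f (flip j a)) =
  2%:R * \sum_a F (restrict a) * f a.
Proof.
move=> jk; under eq_bigr do rewrite mulrDr.
by rewrite big_split /= (sum_restrict_flip F f jk) mulr_natl mulr2n.
Qed.

Lemma sgn_restrict k w j (a : 'I_(2 ^ (w + k))) : (j < w)%N ->
  sgn j (restrict a) = sgn (shiftq k j) a.
Proof. by move=> jw; rewrite /sgn qubit_restrict. Qed.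

Lemma beta1E n (c : circuit n) x :
  beta1 R c x = \tr (unitary R c x * diag (sgn 0) * adjoint (unitary R c x) *
                     pauliZ R (width c) 0) / 2%:R ^+ width c.
Proof. by rewrite /beta1 {1}pauliZE. Qed.

Lemma beta2_widen n (c : circuit n) x :
  beta2 R (widen 1 (fun=> [::]) c) x = beta1 R c x.
Proof.
have w0 := width_gt0 c.
rewrite beta2E /=; last by rewrite addn1.
rewrite unitary_widen big_nil if_same.
rewrite (@trace_widened 1 _ _ 1 _ (two_pure 0 1)) //; last first.
  by rewrite adjoint1 mulr1 mul1r.
rewrite beta1E trace_evolved; set B := _ * _ * _.
rewrite -(@sum_restrict 1 _ w0 (fun a => B a a * sgn 0 a)).
congr (_ / _); have two : (2%:R : C) != 0 by rewrite pnatr_eq0.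
(* The factor 2 pays for averaging over qubit 1, under which the terms containing [sgn 1] cancel. *)
apply: (mulfI two).
rewrite -(@trace_ancilla 1 _ (fun a => B a a) _ 1) // mulr_sumr.
apply: eq_bigr => a _; rewrite sgn_restrict //= /two_pure.
rewrite sgn_flip ?sgn_flip_neq ?addn1 //.
by rewrite /shiftq /=; ring.
Qed.

(** The terms are nested as three uses of [trace_ancilla] produce them; eight times the mean of a
    quarter gives the factor 2. *)
Lemma sum_mux x t a c d (s := fun b : bool => (-1) ^+ b : C) :
  let S a c d := s (mux x t a c d) in
  S a c d + S a c (~~ d) + (S a (~~ c) d + S a (~~ c) (~~ d)) +
  (S (~~ a) c d + S (~~ a) c (~~ d) +
   (S (~~ a) (~~ c) d + S (~~ a) (~~ c) (~~ d))) =
  2%:R * (s x + s t + s x * s t).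
Proof.
by rewrite /s; case: x; case: t; case: a; case: c; case: d;
  rewrite /= ?expr0 ?expr1; ring.
Qed.

Lemma beta1_widen n (c : circuit n) x : (1 < width c)%N -> ~~ nilp (steps c) ->
  beta1 R (widen 3 mux_gadget c) x = beta2 R c x / 4%:R.
Proof.
move=> w1 /negPf s0; have w0 := width_gt0 c.
have lt i : (i <= 4)%N -> (i < width c + 3)%N by lia.
rewrite beta1E unitary_widen s0 /=.
have [p pV pmux] := monomial_mux_gadget (lt 4 isT).
rewrite (trace_widened _ w0 (monomial_conj _ pV)).
rewrite beta2E // trace_evolved; set B := _ * _ * _.
rewrite -(@sum_restrict 3 _ w0 (fun a => B a a * two_pure 0 1 a)).
rewrite mulrAC; congr (_ / _).
have two : (2%:R : C) != 0 by rewrite pnatr_eq0.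
(* One factor 2 for each of the random qubits 3, 2, 1. *)
apply: (mulfI two); apply: (mulfI two); apply: (mulfI two).
rewrite -(@trace_ancilla 3 _ (fun a => B a a) (sgn 0 \o p) 3) //.
rewrite -(@trace_ancilla 3 _ (fun a => B a a) _ 2) //.
rewrite -(@trace_ancilla 3 _ (fun a => B a a) _ 1) //.
set S := (X in X / 4%:R).
have -> : 2%:R * (2%:R * (2%:R * (S / 4%:R))) = 2%:R * S.
  by field.
rewrite mulr_sumr; apply: eq_bigr => a _; rewrite mulrCA; congr (_ * _).
rewrite /two_pure !sgn_restrict //.
rewrite -[RHS](sum_mux _ _ (qubit 1 a) (qubit 2 a) (qubit 3 a)).
by rewrite /sgn /= !pmux !qubit_flip ?lt //= !addbF !addbT.
Qed.

(** A circuit without steps receives no gadget, so its bias is not divided by 4; it is 1 before and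
    after widening. *)
Lemma beta1_nil n (c : circuit n) x : nilp (steps c) -> beta1 R c x = 1.
Proof.
move=> /nilP c0; rewrite /beta1 /unitary c0 big_nil adjoint1 mul1r mulr1.
rewrite pauliZE diag_mul trace_diag.
under eq_bigr do rewrite -signr_addb addbb.
by rewrite sumr_const card_ord natrX divff.
Qed.

Lemma beta2_nil n (c : circuit n) x : (1 < width c)%N -> nilp (steps c) ->
  beta2 R c x = 1.
Proof.
move=> w1 /nilP c0; have w0 := width_gt0 c; rewrite beta2E //.
rewrite /unitary c0 big_nil adjoint1 mul1r mulr1 pauliZE diag_mul.
have -> : diag (fun a => two_pure 0 1 a * (-1) ^+ qubit 0 a) =
    1 + diag (sgn 1) + diag (fun a => sgn 0 a * sgn 1 a) :> 'M[C]_(2 ^ width c).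
  rewrite -mono1 !diagD; apply: eq_diag => a; rewrite /two_pure /sgn.
  by case: (qubit 0 a); rewrite ?expr0 ?expr1; ring.
rewrite !mxtraceD mxtrace1 !(@trace_diag_odd _ 1) ?addr0 ?natrX ?divff // => a.
- by rewrite sgn_flip_neq // sgn_flip // mulrN.
- by rewrite sgn_flip.
Qed.

End Biases.
End Matrices.

(** * The two inclusions *)

Section Classes.
Variable R : realType.
Local Open Scope complex_scope.
Local Open Scope ring_scope.
Local Notation C := R[i].

(** The threshold 1/(4q) suits both cases: a bias divided by 4 and the unchanged bias of an empty
    circuit. *)
Lemma separates_shrunk (b b' : forall n, n.-tuple bool -> C) (q : nat -> R) L :
  (forall n, 0 < q n) ->
  (forall n x, b' n x = b n x \/ b' n x = b n x / 4%:R) ->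
  separates b q L -> separates b' (fun n => 4%:R * q n) L.
Proof.
move=> q0 bb' sep n x; have [yes no] := sep n x.
have four : (4%:R * q n)^-1 = (q n)^-1 / 4%:R by rewrite invfM mulrC.
have fourC (r : R) : (r / 4%:R)%:C = r%:C / 4%:R.
  by rewrite rmorphM fmorphV rmorph_nat.
have le4 : (q n)^-1 / 4%:R <= (q n)^-1.
  by have : 0 < (q n)^-1 by [rewrite invr_gt0]; lra.
rewrite four; case: (bb' n x) => ->; split.
- by move=> /yes; apply: le_trans; rewrite lecR.
- by move=> /no/le_trans; apply; rewrite lecR lerN2.
- by move=> /yes; rewrite fourC ler_pM2r // invr_gt0 ltr0n.
- by move=> /no; rewrite -mulNr fourC ler_pM2r // invr_gt0 ltr0n.
Qed.

Lemma positive_poly_boundedZ (q : nat -> R) :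
  positive_poly_bounded q -> positive_poly_bounded (fun n => 4%:R * q n).
Proof.
move=> [q0 [p qp]]; split=> [n|]; first by rewrite mulr_gt0 ?ltr0n.
by exists (4%:R *: p) => n; rewrite hornerZ ler_pM2l ?ltr0n.
Qed.

Lemma BQ1P_sub_BQ2P : (BQ1P R `<=` BQ2P R)%classic.
Proof.
move=> L [D [q [uD qb sep]]].
exists (fun n => widen 1 (fun=> [::]) (D n)), q; split => //.
- by apply: (@uniform_widen _ _ _ [::]) uD.
- by move=> n /=; rewrite addn1 ltnS; apply: width_gt0.
- by move=> n x; rewrite beta2_widen; apply: sep.
Qed.

Lemma BQ2P_sub_BQ1P : (BQ2P R `<=` BQ1P R)%classic.
Proof.
move=> L [D [q [uD w2 qb sep]]].
exists (fun n => widen 3 mux_gadget (D n)), (fun n => 4%:R * q n); split.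
- apply: uniform_widen uD => n; apply: constant_word_mux.
  (* Width at least 2 becomes at least 5, so qubit 4, the former qubit 1, exists. *)
  by have := w2 n; lia.
- exact: positive_poly_boundedZ.
- apply: separates_shrunk sep => [|n x]; first by case: qb.
  case s0: (nilp (steps (D n))); [left | right].
    rewrite beta2_nil // beta1_nil //=.
    by case: (steps (D n)) s0.
  by apply: beta1_widen; rewrite ?s0.
Qed.

End Classes.

Theorem lemma3 (R : realType) : BQ2P R = BQ1P R.
Proof.
by apply/seteqP; split; [apply: BQ2P_sub_BQ1P | apply: BQ1P_sub_BQ2P].
Qed.
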